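(* If $R$ is a purely infinite simple ring, then $\mathcal{V}(R)\cong \{0\}\sqcup K_0(R)$ as monoids, and $K_0(R)^+=K_0(R)$.
   Context: All rings and modules are unital. An idempotent $e$ in a ring $R$ is infinite if there exist orthogonal idempotents $f,g\in R$ with $e=f+g$, $g\neq 0$ and $eR\cong fR$ as right $R$-modules. A simple ring $R$ is purely infinite if every nonzero right ideal of $R$ contains an infinite idempotent. $\mathcal{V}(R)$ denotes the commutative monoid of isomorphism classes $[A]$ of finitely generated projective right $R$-modules with operation $[A]+[B]=[A\oplus B]$. $K_0(R)$ is the universal (Grothendieck) group of $\mathcal{V}(R)$, and $K_0(R)^+$ is the image of the canonical monoid homomorphism $\mathcal{V}(R)\to K_0(R)$. For an additive monoid $M$, $\{0\}\sqcup M$ denotes the monoid obtained from $M$ by adjoining a new zero element. *)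

(* Defs.v *)
From HB Require Import structures.
From mathcomp Require Import all_boot ssralg matrix generic_quotient.
From mathcomp Require Import boolp classical_sets.

Set Implicit Arguments.
Unset Strict Implicit.
Unset Printing Implicit Defensive.

Import GRing.Theory.
Local Open Scope ring_scope.
Local Open Scope classical_set_scope.
Local Open Scope quotient_scope.

(** Right R-modules are the left modules [lmodType R^c] over the converse ring:
    for M : lmodType R^c, [r *: m] is what is usually written m r. *)

Section Modules.
Variable S : nzRingType.

Definition mod_iso (A B : lmodType S) : Prop :=
  exists f : {linear A -> B}, bijective f.

Definition finitely_generated (A : lmodType S) : Prop :=
  exists (n : nat) (s : 'I_n -> A),
    forall x : A, exists c : 'I_n -> S, x = \sum_i c i *: s i.

Definition projective (A : lmodType S) : Prop :=
  forall (B C : lmodType S) (p : {linear B -> C}) (f : {linear A -> C}),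
    (forall c : C, exists b : B, p b = c) ->
    exists g : {linear A -> B}, forall a : A, p (g a) = f a.

Lemma mod_iso_refl (A : lmodType S) : mod_iso A A.
Proof. by exists idfun; exists idfun. Qed.

Lemma mod_iso_trans (A B C : lmodType S) :
  mod_iso A B -> mod_iso B C -> mod_iso A C.
Proof. by move=> [f bf] [g bg]; exists (g \o f); apply: bij_comp. Qed.

Lemma linear_can (A B : lmodType S) (f : {linear A -> B}) (g : B -> A) :
  cancel f g -> cancel g f -> linear g.
Proof.
by move=> fK gK a x y; apply: (can_inj fK); rewrite linearP !gK.
Qed.

Lemma mod_iso_sym (A B : lmodType S) : mod_iso A B -> mod_iso B A.
Proof.
move=> [f [g fK gK]]; have gL := linear_can fK gK.
pose gl := GRing.isLinear.Build S B A _ g gL.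
pose g' : {linear B -> A} := HB.pack g gl.
by exists g'; exists f.
Qed.

Lemma bij_of_inj_surj (X : choiceType) (Y : eqType) (f : X -> Y) :
  injective f -> (forall y, exists x, f x = y) -> bijective f.
Proof.
move=> fI fS; have fS' y : exists x, f x == y by have [x /eqP] := fS y; exists x.
exists (fun y => xchoose (fS' y)) => [x|y]; last exact/eqP/(xchooseP (fS' y)).
exact/fI/eqP/(xchooseP (fS' (f x))).
Qed.

Record fgproj := FgProj {
  fgproj_mod :> lmodType S;
  fgproj_fg : finitely_generated fgproj_mod;
  fgproj_proj : projective fgproj_mod }.

Lemma fg_zero : finitely_generated 'rV[S]_0.
Proof.
exists 0, (fun=> 0) => x; exists (fun=> 0); rewrite big_ord0.
by apply/rowP => - [].
Qed.

Lemma proj_zero : projective 'rV[S]_0.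
Proof.
move=> B C p f _; exists \0 => x.
have -> : x = 0 by apply/rowP => - [].
by rewrite !linear0.
Qed.

Definition fgproj_zero : fgproj := FgProj fg_zero proj_zero.

Lemma fg_prod (A B : lmodType S) :
  finitely_generated A -> finitely_generated B -> finitely_generated (A * B)%type.
Proof.
move=> [m [s sP]] [n [t tP]].
exists (m + n)%N, (fun i => match split i with
                            | inl j => (s j, 0) | inr j => (0, t j) end).
move=> [a b]; have [c ->] := sP a; have [d ->] := tP b.
exists (fun i => match split i with inl j => c j | inr j => d j end).
rewrite big_split_ord /=.
have El i : split (lshift n i) = inl i := unsplitK (inl i : 'I_m + 'I_n)%type.
have Er i : split (rshift m i) = inr i := unsplitK (inr i : 'I_m + 'I_n)%type.
under [X in _ = X + _]eq_bigr do rewrite El.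
under [X in _ = _ + X]eq_bigr do rewrite Er.
rewrite [RHS]surjective_pairing; congr (_, _).
- rewrite raddfD /= !(raddf_sum fst) /= [X in _ + X]big1 ?addr0 // => i _.
  by rewrite scaler0.
- rewrite raddfD /= !(raddf_sum snd) /= [X in X + _]big1 ?add0r // => i _.
  by rewrite scaler0.
Qed.

Lemma proj_prod (A B : lmodType S) :
  projective A -> projective B -> projective (A * B)%type.
Proof.
move=> pA pB X Y p f ps.
have l1 : linear (fun a : A => (a, 0) : A * B).
  by move=> k a a'; congr (_, _); rewrite /= scaler0 addr0.
have l2 : linear (fun b : B => (0, b) : A * B).
  by move=> k a a'; congr (_, _); rewrite /= scaler0 addr0.
pose i1 : {linear A -> (A * B)%type} :=
  HB.pack (fun a : A => (a, 0) : A * B) (GRing.isLinear.Build S A _ _ _ l1).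
pose i2 : {linear B -> (A * B)%type} :=
  HB.pack (fun b : B => (0, b) : A * B) (GRing.isLinear.Build S B _ _ _ l2).
have [g1 g1P] := pA _ _ p (f \o i1) ps.
have [g2 g2P] := pB _ _ p (f \o i2) ps.
exists ((g1 \o fst) \+ (g2 \o snd)) => -[a b] /=.
rewrite linearD g1P g2P /= -linearD; congr (f _).
by congr (_, _); rewrite /= ?addr0 ?add0r.
Qed.

Definition fgproj_sum (A B : fgproj) : fgproj :=
  FgProj (fg_prod (fgproj_fg A) (fgproj_fg B))
         (proj_prod (@fgproj_proj A) (@fgproj_proj B)).

Lemma fgproj_embed (A : fgproj) :
  exists n (f : {linear A -> 'rV[S]_n}), injective f.
Proof.
have [n [s sP]] := fgproj_fg A.
have pL : linear (fun v : 'rV[S]_n => \sum_i v ord0 i *: s i).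
  move=> k u v; rewrite scaler_sumr -big_split /=; apply: eq_bigr => i _.
  by rewrite !mxE scalerDl scalerA.
pose p : {linear 'rV[S]_n -> A} :=
  HB.pack (fun v : 'rV[S]_n => \sum_i v ord0 i *: s i)
    (GRing.isLinear.Build S _ A _ _ pL).
have ps (a : A) : exists v, p v = a.
  have [c ->] := sP a; exists (\row_i c i); rewrite /p /=.
  by apply: eq_bigr => i _; rewrite mxE.
have [g gP] := @fgproj_proj A _ _ p idfun ps.
by exists n, g; apply: (can_inj gP).
Qed.

Lemma mod_iso_prod (A A' B B' : lmodType S) : mod_iso A A' -> mod_iso B B' ->
  mod_iso (A * B)%type (A' * B')%type.
Proof.
move=> [f [f' fK f'K]] [g [g' gK g'K]].
have hL : linear (fun x : A * B => (f x.1, g x.2)).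
  by move=> k x y; congr (_, _); rewrite /= linearP.
pose h : {linear (A * B)%type -> (A' * B')%type} :=
  HB.pack (fun x : A * B => (f x.1, g x.2)) (GRing.isLinear.Build S _ _ _ _ hL).
exists h; exists (fun x => (f' x.1, g' x.2)) => -[a b];
  by rewrite /h /= ?fK ?gK ?f'K ?g'K.
Qed.

Lemma mod_iso_prodC (A B : lmodType S) : mod_iso (A * B)%type (B * A)%type.
Proof.
have hL : linear (fun x : A * B => (x.2, x.1)) by [].
pose h : {linear (A * B)%type -> (B * A)%type} :=
  HB.pack (fun x : A * B => (x.2, x.1)) (GRing.isLinear.Build S _ _ _ _ hL).
by exists h; exists (fun x => (x.2, x.1)) => -[].
Qed.

Lemma mod_iso_prodA (A B C : lmodType S) :
  mod_iso (A * (B * C))%type ((A * B) * C)%type.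
Proof.
have hL : linear (fun x : A * (B * C) => ((x.1, x.2.1), x.2.2)) by [].
pose h : {linear (A * (B * C))%type -> ((A * B) * C)%type} :=
  HB.pack (fun x : A * (B * C) => ((x.1, x.2.1), x.2.2))
    (GRing.isLinear.Build S _ _ _ _ hL).
by exists h; exists (fun x => (x.1.1, (x.1.2, x.2))) => [[a []]|[[]]].
Qed.

Lemma mod_iso_prod0 (A : lmodType S) : mod_iso ('rV[S]_0 * A)%type A.
Proof.
exists (snd : {linear ('rV[S]_0 * A)%type -> A}); exists (fun a => (0, a)) => //.
by move=> [x a] /=; congr (_, _); apply/rowP => - [].
Qed.

(** The f.g. projective modules do not form a type that can carry a
    [choiceType].  The isomorphism class of A is therefore recorded by its
    members that are submodules of some free module S^n. Every f.g. projective
    module embeds in such an S^n, so this loses nothing: [viso_eqP] below states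
    that two recorded classes are equal iff the modules are isomorphic. *)
Definition iso_class (A : lmodType S) : set {n & set 'rV[S]_n} :=
  [set N | exists f : {linear A -> 'rV[S]_(projT1 N)},
             injective f /\ range f = projT2 N].

Lemma iso_classP (A B : fgproj) : iso_class A = iso_class B <-> mod_iso A B.
Proof.
split=> [eAB|].
  have [n [f fI]] := fgproj_embed A.
  have : iso_class A (existT _ n (range f)) by exists f.
  rewrite eAB => -[g [/= gI rg]].
  have ex (a : A) : exists b : B, g b == f a.
    by have : range f (f a) by []; rewrite -rg => -[b _ <-]; exists b.
  pose h a := xchoose (ex a).
  have hE a : g (h a) = f a by exact/eqP/(xchooseP (ex a)).
  have hL : linear h by move=> k a a'; apply: gI; rewrite linearP !hE linearP.
  pose h' : {linear A -> B} := HB.pack h (GRing.isLinear.Build S _ _ _ _ hL).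
  exists h'; apply: bij_of_inj_surj => [a a' /(congr1 g)|b].
    by rewrite !hE => /fI.
  have : range g (g b) by []; rewrite rg => -[a _ fa]; exists a.
  by apply: gI; rewrite hE.
have sub (X Y : lmodType S) : mod_iso X Y -> iso_class X `<=` iso_class Y.
  move=> /mod_iso_sym [h [h' hK h'K]] N [f [fI rf]].
  exists (f \o h); split; first exact: inj_comp fI (can_inj hK).
  rewrite -rf; apply/seteqP; split=> v [x _ <-]; first by exists (h x).
  by exists (h' x) => //=; rewrite h'K.
by move=> i; apply/seteqP; split; apply: sub => //; apply: mod_iso_sym.
Qed.

Record viso := VIso {
  viso_val : set {n & set 'rV[S]_n};
  viso_valP : exists A : fgproj, viso_val = iso_class A }.

Definition viso_cls (A : fgproj) : viso := VIso (ex_intro _ A erefl).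

Lemma viso_eqP (A B : fgproj) : viso_cls A = viso_cls B <-> mod_iso A B.
Proof.
rewrite -iso_classP; split=> [[]//|e].
rewrite /viso_cls; move: (ex_intro _ _ _) (ex_intro _ _ _); rewrite e => p q.
by congr VIso; apply: Prop_irrelevance.
Qed.

Lemma viso_surj (x : viso) : exists A : fgproj, viso_cls A = x.
Proof.
case: x => X [A eA]; exists A; rewrite /viso_cls.
by move: (ex_intro _ _ _) (ex_intro _ _ _); rewrite -eA => p q; congr VIso.
Qed.

Definition viso_repr (x : viso) : fgproj := projT1 (cid (viso_surj x)).

Lemma viso_reprK x : viso_cls (viso_repr x) = x.
Proof. exact: projT2 (cid (viso_surj x)). Qed.

Definition viso_add (x y : viso) : viso :=
  viso_cls (fgproj_sum (viso_repr x) (viso_repr y)).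

Lemma viso_addE (A B : fgproj) :
  viso_add (viso_cls A) (viso_cls B) = viso_cls (fgproj_sum A B).
Proof.
by apply/viso_eqP/mod_iso_prod; apply/viso_eqP; rewrite viso_reprK.
Qed.

Lemma viso_addA : associative viso_add.
Proof.
move=> x y z; rewrite -(viso_reprK x) -(viso_reprK y) -(viso_reprK z).
by rewrite !viso_addE; apply/viso_eqP/mod_iso_prodA.
Qed.

Lemma viso_addC : commutative viso_add.
Proof.
move=> x y; rewrite -(viso_reprK x) -(viso_reprK y) !viso_addE.
exact/viso_eqP/mod_iso_prodC.
Qed.

Lemma viso_add0 : left_id (viso_cls fgproj_zero) viso_add.
Proof.
move=> x; rewrite -(viso_reprK x) viso_addE; exact/viso_eqP/mod_iso_prod0.
Qed.

HB.instance Definition _ := gen_eqMixin viso.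
HB.instance Definition _ := gen_choiceMixin viso.
HB.instance Definition _ :=
  GRing.isNmodule.Build viso viso_addA viso_addC viso_add0.

End Modules.

Definition V (R : nzRingType) : nmodType := viso R^c.

Definition V_class (R : nzRingType) (A : fgproj R^c) : V R := viso_cls A.

Lemma V_class_eqP (R : nzRingType) (A B : fgproj R^c) :
  V_class A = V_class B <-> mod_iso A B.
Proof. exact: viso_eqP. Qed.

Lemma V_class_surj (R : nzRingType) (x : V R) : exists A, V_class A = x.
Proof. exact: viso_surj. Qed.

Lemma V_classD (R : nzRingType) (A B : fgproj R^c) :
  V_class A + V_class B = V_class (fgproj_sum A B).
Proof. exact: viso_addE. Qed.

(** The Grothendieck group of M, as formal differences x.1 - x.2; its universal
    property is [groth_universal]. *)
Section Grothendieck.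
Variable M : nmodType.

Definition groth_rel (x y : M * M) : bool :=
  `[< exists e : M, x.1 + y.2 + e = y.1 + x.2 + e >].

Lemma groth_rel_refl : reflexive groth_rel.
Proof. by move=> x; apply/asboolP; exists 0. Qed.

Lemma groth_rel_sym : symmetric groth_rel.
Proof. by move=> x y; apply/asboolP/asboolP => -[e ee]; exists e. Qed.

Lemma groth_rel_trans : transitive groth_rel.
Proof.
move=> [y1 y2] [x1 x2] [z1 z2] /asboolP[e /= h1] /asboolP[f /= h2].
apply/asboolP; exists (y1 + y2 + e + f) => /=.
rewrite (AC (2*4) ((1*4*5)*(3*2*6))) /= h1 h2.
by rewrite (AC (3*3) ((4*2)*(1*5*3*6))).
Qed.

Definition groth_eqv :=
  EquivRel groth_rel groth_rel_refl groth_rel_sym groth_rel_trans.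

Definition groth := {eq_quot groth_eqv}.

HB.instance Definition _ := Choice.on groth.
HB.instance Definition _ := EqQuotient.on groth.

Lemma groth_eqP (x y : M * M) :
  \pi_groth x = \pi_groth y <-> exists e : M, x.1 + y.2 + e = y.1 + x.2 + e.
Proof.
split=> [h|h].
  by apply/asboolP/(@eqmodP _ groth_eqv).
by apply/(@eqmodP _ groth_eqv)/asboolP.
Qed.

Definition groth_add (x y : groth) : groth := \pi_groth (repr x + repr y).
Definition groth_opp (x : groth) : groth := \pi_groth ((repr x).2, (repr x).1).

Lemma groth_addE (x y : M * M) :
  groth_add (\pi_groth x) (\pi_groth y) = \pi_groth (x + y).
Proof.
rewrite /groth_add; case: piP => x' /groth_eqP[e ee].
case: piP => y' /groth_eqP[f ff]; apply/groth_eqP; exists (e + f) => /=.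
rewrite (AC ((2*2)*2) ((1*3*5)*(2*4*6))) /= -ee -ff.
by rewrite (AC (3*3) ((1*4)*(2*5)*(3*6))).
Qed.

Lemma groth_oppE (x : M * M) : groth_opp (\pi_groth x) = \pi_groth (x.2, x.1).
Proof.
rewrite /groth_opp; case: piP => x' /groth_eqP[e ee].
by apply/groth_eqP; exists e; rewrite /= (addrC x'.2) (addrC x.2).
Qed.

Lemma groth_addA : associative groth_add.
Proof.
elim/quotW=> x; elim/quotW=> y; elim/quotW=> z.
by rewrite (groth_addE y z) (groth_addE x) (groth_addE x y) groth_addE addrA.
Qed.

Lemma groth_addC : commutative groth_add.
Proof. by elim/quotW=> x; elim/quotW=> y; rewrite (groth_addE x y) (groth_addE y x) addrC. Qed.

Lemma groth_add0 : left_id (\pi_groth 0) groth_add.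
Proof. by elim/quotW=> x; rewrite groth_addE add0r. Qed.

Lemma groth_addN : left_inverse (\pi_groth 0) groth_opp groth_add.
Proof.
elim/quotW=> x; rewrite groth_oppE groth_addE; apply/groth_eqP.
by exists 0; rewrite /= !addr0 add0r addrC.
Qed.

HB.instance Definition _ :=
  GRing.isZmodule.Build groth groth_addA groth_addC groth_add0 groth_addN.

Definition groth_of (m : M) : groth := \pi_groth (m, 0).

Lemma groth_of_nmod_morphism : nmod_morphism groth_of.
Proof.
split=> // x y; rewrite [RHS]groth_addE; congr (\pi_groth _).
by congr (_, _); rewrite /= addr0.
Qed.

HB.instance Definition _ :=
  GRing.isNmodMorphism.Build M groth groth_of groth_of_nmod_morphism.

Lemma groth_ofP (x y : M) :
  groth_of x = groth_of y <-> exists e : M, x + e = y + e.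
Proof. by rewrite groth_eqP /= !addr0. Qed.

Lemma groth_universal (G : zmodType) (h : {additive M -> G}) :
  exists! k : groth -> G, zmod_morphism k /\ forall m, k (groth_of m) = h m.
Proof.
pose k (x : groth) := h (repr x).1 - h (repr x).2.
have kE x : k (\pi_groth x) = h x.1 - h x.2.
  rewrite /k; case: piP => y /groth_eqP[e /(congr1 h)].
  rewrite !raddfD => /addIr ee.
  by apply/eqP; rewrite subr_eq addrAC eq_sym subr_eq ee.
have xE (x : M * M) : \pi_groth x = groth_of x.1 - groth_of x.2.
  rewrite /groth_of [X in _ = _ + X]groth_oppE [RHS]groth_addE.
  by congr (\pi_groth _); case: x => a b; congr (_, _); rewrite /= ?addr0 ?add0r.
exists k; split.
  split; last by move=> m; rewrite kE raddf0 subr0.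
  elim/quotW=> x; elim/quotW=> y.
  rewrite [X in _ + X]groth_oppE [X in k X]groth_addE !kE /=.
  by rewrite (raddfD h x.1) (raddfD h x.2) opprD opprB addrACA.
move=> k' [kB kh]; apply/funext; elim/quotW=> x.
by rewrite kE xE kB !kh.
Qed.

End Grothendieck.

Definition K0 (R : nzRingType) : zmodType := groth (V R).

Definition K0_pos (R : nzRingType) : set (K0 R) := range (@groth_of (V R)).
Arguments K0_pos : clear implicits.

(** {0} \sqcup M: [None] is the new zero, [Some] embeds M. *)
Section AdjoinZero.
Variable M : nmodType.

Definition adjoin_zero := option M.

Definition az_add (x y : adjoin_zero) : adjoin_zero :=
  match x, y with
  | None, _ => y
  | _, None => x
  | Some a, Some b => Some (a + b)
  end.

Lemma az_addA : associative az_add.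
Proof. by move=> [a|] [b|] [c|] //=; rewrite addrA. Qed.

Lemma az_addC : commutative az_add.
Proof. by move=> [a|] [b|] //=; rewrite addrC. Qed.

Lemma az_add0 : left_id None az_add.
Proof. by []. Qed.

HB.instance Definition _ := Choice.on adjoin_zero.
HB.instance Definition _ :=
  GRing.isNmodule.Build adjoin_zero az_addA az_addC az_add0.

End AdjoinZero.

Definition monoid_iso (M N : nmodType) : Prop :=
  exists f : {additive M -> N}, bijective f.

(** The right ideal e R, as a submodule of R viewed as a right module over
    itself: the product below is that of R, the scalar action that of R^c. *)
Section PrincipalRightIdeal.
Variables (R : nzRingType) (e : R).

Definition in_eR : {pred (R^c)^o} := fun x => `[< exists r : R, x = e * r >].

Lemma in_eR_submod : submod_closed in_eR.
Proof.
split=> [|a x y]; first by apply/asboolP; exists 0; rewrite mulr0.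
move=> /asboolP[r ->] /asboolP[s ->]; apply/asboolP.
by exists (r * (a : R) + s); rewrite mulrDr mulrA.
Qed.

HB.instance Definition _ :=
  GRing.isSubmodClosed.Build R^c (R^c)^o in_eR in_eR_submod.

Record eR := ER { eR_val :> (R^c)^o; _ : eR_val \in in_eR }.

HB.instance Definition _ := [isSub for eR_val].
HB.instance Definition _ := [Choice of eR by <:].
HB.instance Definition _ := [SubChoice_isSubLmodule of eR by <:].

End PrincipalRightIdeal.

Definition infinite_idempotent (R : nzRingType) (e : R) : Prop :=
  e * e = e /\
  exists f g : R,
    [/\ f * f = f, g * g = g & f * g = 0 /\ g * f = 0] /\
    [/\ e = f + g, g <> 0 & @mod_iso R^c (eR e) (eR f)].

Definition right_ideal (R : nzRingType) (I : set R) : Prop :=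
  [/\ I 0, forall x y, I x -> I y -> I (x - y) & forall x r, I x -> I (x * r)].

Definition two_sided_ideal (R : nzRingType) (I : set R) : Prop :=
  right_ideal I /\ forall r x, I x -> I (r * x).

(** R is nonzero because it is a [nzRingType]. *)
Definition simple_ring (R : nzRingType) : Prop :=
  forall I : set R, two_sided_ideal I -> I = [set 0] \/ I = setT.

Definition purely_infinite_simple (R : nzRingType) : Prop :=
  simple_ring R /\
  forall I : set R, right_ideal I -> I <> [set 0] ->
    exists2 e, I e & infinite_idempotent e.

(* Main.v *)
Require Import Defs.
From HB Require Import structures.
From mathcomp Require Import all_boot ssralg.
From mathcomp Require Import matrix generic_quotient.
From mathcomp Require Import boolp classical_sets.

(** Call an element [x] of a commutative monoid a summand of [y] when
    [y = x + z] for some [z].  The heart of the matter is that in [V R] every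
    element, zero or not, is a summand of every nonzero element, with a nonzero
    complement ([nonzero_absorbs]).  Since the sum of two nonzero elements of
    [V R] is nonzero, this divisibility makes the nonzero elements of [V R] a
    group; such a monoid is its Grothendieck group with a new zero adjoined
    ([monoid_iso_adjoin_zero_groth], [groth_of_surj]).

    To see the divisibility, take a nonzero f.g. projective module [A].  A
    nonzero coordinate functional on [A] has as its image a nonzero right ideal,
    which contains an infinite idempotent [e]; as [eR] is projective, the class
    of [eR] is a summand of the class of [A] ([infinite_idempotent_summand]).
    Being infinite, [e] gives [[eR] = [eR] + [gR]] for a nonzero idempotent [g],
    hence [[eR] = [eR] + n [gR]] for all [n].  Finally [R] is simple, so that [g]
    generates [R] as a two-sided ideal; writing 1 as a sum of terms [x g y]
    shows that any f.g. projective module is a summand of a power of [gR]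
    ([summand_of_idempotent_multiple]), and therefore of [eR] and of [A]. *)

Set Implicit Arguments.
Unset Strict Implicit.
Unset Printing Implicit Defensive.

Import GRing.Theory.
Local Open Scope ring_scope.
Local Open Scope quotient_scope.
Local Open Scope classical_set_scope.

(** * Retracts and direct complements of modules *)

Definition linear_of (S : nzRingType) (A B : lmodType S) (f : A -> B)
    (fL : linear f) : {linear A -> B} :=
  HB.pack f (GRing.isLinear.Build S A B _ f fL).

Section Kernel.
Variables (S : nzRingType) (A B : lmodType S) (p : {linear A -> B}).

Definition in_kernel : {pred A} := fun x => p x == 0.

Lemma in_kernel_submod : submod_closed in_kernel.
Proof.
split=> [|k x y]; first by rewrite /in_kernel unfold_in linear0.
by rewrite !unfold_in /in_kernel linearP => /eqP -> /eqP ->; rewrite scaler0 addr0.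
Qed.

HB.instance Definition _ :=
  GRing.isSubmodClosed.Build S A in_kernel in_kernel_submod.

Record kernel := Kernel { kernel_val :> A; _ : kernel_val \in in_kernel }.

HB.instance Definition _ := [isSub for kernel_val].
HB.instance Definition _ := [Choice of kernel by <:].
HB.instance Definition _ := [SubChoice_isSubLmodule of kernel by <:].

End Kernel.

Section Retracts.
Variable S : nzRingType.

Lemma fg_retract (A B : lmodType S) (i : {linear A -> B}) (p : {linear B -> A}) :
  cancel i p -> finitely_generated B -> finitely_generated A.
Proof.
move=> ipK [n [s sP]]; exists n, (p \o s) => x.
have [c cP] := sP (i x); exists c.
by rewrite -[LHS]ipK cP linear_sum; apply: eq_bigr => j _; rewrite linearZ.
Qed.

Lemma proj_retract (A B : lmodType S) (i : {linear A -> B}) (p : {linear B -> A}) :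
  cancel i p -> projective B -> projective A.
Proof.
move=> ipK pB X Y q f qs; have [g gP] := pB _ _ q (f \o p) qs.
by exists (g \o i) => a /=; rewrite gP /= ipK.
Qed.

(** The complement is the kernel of the retraction, onto which
    [b |-> b - i (p b)] is a projection. *)
Lemma retract_summand (A B : fgproj S) (i : {linear A -> B})
    (p : {linear B -> A}) :
  cancel i p -> exists z : viso S, viso_cls B = viso_cls A + z.
Proof.
move=> ipK.
have kP (b : B) : b - i (p b) \in in_kernel p.
  by rewrite unfold_in /in_kernel linearB ipK subrr.
pose q b : kernel p := Kernel (kP b).
have qL : linear q.
  move=> k x y; apply: val_inj; rewrite [RHS]linearP /=.
  by rewrite (linearP p) (linearP i) opprD addrACA -scalerBr.
pose q' : {linear B -> kernel p} := linear_of qL.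
have p0 (x : kernel p) : p (val x) = 0 by apply/eqP; case: x.
have qK : cancel (val : {linear kernel p -> B}) q'.
  by move=> x; apply: val_inj; rewrite /= p0 linear0 subr0.
pose C := FgProj (fg_retract qK (fgproj_fg B)) (proj_retract qK (@fgproj_proj _ B)).
exists (viso_cls C); rewrite [RHS]viso_addE; apply/viso_eqP.
have hL : linear (fun b : B => (p b, q b)).
  by move=> k x y; congr (_, _); rewrite ?linearP // qL.
exists (linear_of (B := (A * C)%type) hL); exists (fun x => i x.1 + val x.2) => [b|[a c]] /=.
  by rewrite addrC subrK.
congr (_, _); first by rewrite linearD ipK p0 addr0.
by apply: val_inj; rewrite /= linearD ipK p0 addr0 addrC addKr.
Qed.

Fixpoint fgproj_pow (G : fgproj S) (n : nat) : fgproj S :=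
  if n is m.+1 then fgproj_sum G (fgproj_pow G m) else fgproj_zero S.

Lemma viso_cls_pow (G : fgproj S) n :
  viso_cls (fgproj_pow G n) = viso_cls G *+ n :> viso S.
Proof.
elim: n => [|n IH] //=.
by rewrite mulrS -IH; symmetry; apply: viso_addE.
Qed.

(** The [n] maps [A -> G] assemble into one map [A -> G ^ n], and the [n] maps
    [G -> A] into one map [G ^ n -> A]; their composite is the given sum, so
    that [A] is a retract of [G ^ n]. *)
Lemma summand_of_multiple (A G : fgproj S)
    (l : seq ({linear G -> A} * {linear A -> G})) :
  (forall a, a = \sum_(uv <- l) uv.1 (uv.2 a)) ->
  exists z : viso S, viso_cls G *+ size l = viso_cls A + z.
Proof.
move=> lP.
have [U [W UW]] : exists (U : {linear fgproj_pow G (size l) -> A})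
    (W : {linear A -> fgproj_pow G (size l)}),
    forall a, U (W a) = \sum_(uv <- l) uv.1 (uv.2 a).
  elim: l {lP} => [|[u v] l [U [W UW]]] /=.
    by exists \0, \0 => a; rewrite big_nil.
  have WL : linear (fun a : A => (v a, W a)).
    by move=> k x y; congr (_, _); rewrite linearP.
  exists ((u \o fst) \+ (U \o snd)).
  exists (linear_of (B := (G * fgproj_pow G (size l))%type) WL).
  by move=> a; rewrite big_cons /= UW.
rewrite -viso_cls_pow; apply: (@retract_summand _ _ W U) => a.
by rewrite UW -lP.
Qed.

(** The coordinates of a section of a surjection [S^n -> A] are functionals
    dual to the images of the basis vectors. *)
Lemma dual_basis (A : fgproj S) :
  exists l : seq (A * {linear A -> S^o}),
    forall a, a = \sum_(sf <- l) (sf.2 a : S) *: sf.1.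
Proof.
have [n [s sP]] := fgproj_fg A.
have pL : linear (fun v : 'rV[S]_n => \sum_i v ord0 i *: s i).
  move=> k u v; rewrite scaler_sumr -big_split /=; apply: eq_bigr => i _.
  by rewrite !mxE scalerDl scalerA.
pose p : {linear 'rV[S]_n -> A} := linear_of pL.
have ps (a : A) : exists v, p v = a.
  have [c ->] := sP a; exists (\row_i c i); rewrite /p /=.
  by apply: eq_bigr => i _; rewrite mxE.
have [g gP] := @fgproj_proj _ A _ _ p idfun ps.
have fL i : linear (fun a : A => g a ord0 i : S^o).
  by move=> k x y; rewrite linearP !mxE.
exists [seq (s i, linear_of (B := S^o) (fL i)) | i <- enum 'I_n] => a.
by rewrite big_map big_enum -[LHS](gP a).
Qed.

Lemma viso_cls_eq0 (A : fgproj S) :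
  (viso_cls A = 0 :> viso S) <-> forall a : A, a = 0.
Proof.
split=> [/viso_eqP[f [f' fK _]] a|A0].
  by apply: (can_inj fK); apply/rowP => - [].
apply/viso_eqP; exists \0; exists (fun=> 0) => [a|x]; first by rewrite (A0 a).
by apply/rowP => - [].
Qed.

Lemma viso_add_eq0 (x y : viso S) : x + y = 0 -> x = 0.
Proof.
have [A <-] := viso_surj x; have [B <-] := viso_surj y.
rewrite [_ + _]viso_addE => /viso_cls_eq0 AB0; apply/viso_cls_eq0 => a.
by have [] := AB0 (a, 0).
Qed.

Lemma fg_regular : finitely_generated S^o.
Proof.
exists 1, (fun=> 1) => x; exists (fun=> x).
by rewrite big_ord1; rewrite -[LHS]mulr1.
Qed.

Lemma proj_regular : projective S^o.
Proof.
move=> B C p f ps; have [b bP] := ps (f 1).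
have gL : linear (fun r : S^o => (r : S) *: b).
  by move=> k x y; rewrite scalerDl scalerA.
exists (linear_of gL) => a /=.
by rewrite linearZ bP -linearZ; congr (f _); apply: mulr1.
Qed.

End Retracts.

(** * Principal right ideals generated by idempotents *)

Section IdempotentIdeals.
Variable R : nzRingType.
Implicit Types e f g : R.

Lemma eR_mulP e (r : R) : (e * r : (R^c)^o) \in in_eR e.
Proof. by apply/asboolP; exists r. Qed.

Definition eR_mul e (r : (R^c)^o) : eR e := ER (eR_mulP e r).

Lemma eR_mul_linear e : linear (eR_mul e).
Proof.
move=> k x y; apply: val_inj; rewrite linearP /= mulrDr; congr (_ + _).
exact: (@mulrA R e x k).
Qed.

HB.instance Definition _ e :=
  GRing.isLinear.Build R^c (R^c)^o (eR e) _ (eR_mul e) (eR_mul_linear e).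

(** The module [eR e] with its structure of [R^c]-module explicit: unification
    does not recover the scalar ring [R^c] from the bare type. *)
Definition eR_mod e : lmodType R^c := eR e.

Lemma eR_mulK e : e * e = e -> forall t : eR e, e * (val t : R) = val t.
Proof. by move=> ee [t tP] /=; have /asboolP[r ->] := tP; rewrite mulrA ee. Qed.

Lemma eR_valK e : e * e = e -> cancel (val : {linear eR e -> (R^c)^o}) (eR_mul e).
Proof. by move=> ee t; apply: val_inj; apply: eR_mulK. Qed.

Definition fgproj_eR e (ee : e * e = e) : fgproj R^c :=
  FgProj (fg_retract (eR_valK ee) (fg_regular _))
         (proj_retract (eR_valK ee) (proj_regular (S := R^c))).

Lemma V_class_eR_neq0 e (ee : e * e = e) :
  e <> 0 -> V_class (fgproj_eR ee) <> 0.
Proof.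
move=> e0 /viso_cls_eq0 /(_ (eR_mul e e)) /(congr1 val) /= h; apply: e0.
by rewrite -ee.
Qed.

Lemma eR_orthogonal_sum e f g : f * f = f -> g * g = g -> f * g = 0 ->
  g * f = 0 -> e = f + g -> mod_iso (eR_mod e) (eR_mod f * eR_mod g)%type.
Proof.
move=> ff gg fg gf ->.
have hL : linear (fun t : eR_mod (f + g) =>
    (eR_mul f (val t), eR_mul g (val t)) : eR_mod f * eR_mod g).
  by move=> k x y; congr (_, _); rewrite !linearP.
exists (linear_of hL).
exists (fun x : eR f * eR g => eR_mul (f + g) ((val x.1 : R) + val x.2)) => [t|[u v]].
  have ee : (f + g) * (f + g) = f + g.
    by rewrite mulrDl !mulrDr ff gg fg gf addr0 add0r.
  by apply: val_inj; rewrite /= -mulrDl !(eR_mulK ee).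
have fu := eR_mulK ff u; have gv := eR_mulK gg v.
have fv : f * (val v : R) = 0 by rewrite -gv mulrA fg mul0r.
have gu : g * (val u : R) = 0 by rewrite -fu mulrA gf mul0r.
have uv : (f + g) * ((val u : R) + val v) = (val u : R) + val v.
  by rewrite mulrDl !mulrDr fu gv fv gu addr0 add0r.
by congr (_, _); apply: val_inj; rewrite /= uv mulrDr ?fu ?gv ?fv ?gu ?addr0 ?add0r.
Qed.

Lemma infinite_idempotent_absorbs e (ee : e * e = e) : infinite_idempotent e ->
  exists g (gg : g * g = g), g <> 0 /\
    V_class (fgproj_eR ee) =
    V_class (fgproj_eR ee) + V_class (fgproj_eR gg).
Proof.
move=> [_ [f [g [[ff gg [fg gf]] [efg g0 ef]]]]]; exists g, gg; split=> //.
have -> : V_class (fgproj_eR ee) + V_class (fgproj_eR gg) =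
          V_class (fgproj_eR ff) + V_class (fgproj_eR gg).
  by congr (_ + _); apply/V_class_eqP.
by rewrite V_classD; apply/V_class_eqP; apply: eR_orthogonal_sum.
Qed.

(** The image of a coordinate functional [phi] of [A] with [phi <> 0] contains
    an infinite idempotent [e = phi a]; then [t |-> a t] embeds [eR] in [A],
    and [x |-> e (phi x)] is a left inverse. *)
Lemma infinite_idempotent_summand (x : V R) :
  purely_infinite_simple R -> x <> 0 ->
  exists e (ee : e * e = e) z, infinite_idempotent e /\
    x = V_class (fgproj_eR ee) + z.
Proof.
move=> [_ piR]; have [A <-] := V_class_surj x => A0.
have [l lP] := dual_basis A.
have [phi [a0 phi0]] : exists (phi : {linear A -> (R^c)^o}) a0, phi a0 <> 0.
  apply: contra_notP A0 => nophi; apply/viso_cls_eq0 => a.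
  rewrite [LHS]lP big1 // => sf _; suff -> : sf.2 a = 0 by rewrite scale0r.
  by apply: contra_notP nophi => ?; exists sf.2, a.
have [|/(congr1 (@^~ (phi a0)))|e [a _ ea] einf] := piR (range phi).
- split=> [|_ _ [u _ <-] [v _ <-]|_ r [u _ <-]].
  + by exists 0; rewrite ?linear0.
  + by exists (u - v); rewrite ?linearB.
  + by exists ((r : R^c) *: u); rewrite ?linearZ.
- move=> h; apply: phi0; suff : [set 0] (phi a0) by [].
  by rewrite -h; exists a0.
have ee : e * e = e by case: einf.
exists e, ee.
have iL : linear (fun t : eR_mod e => (val t : R^c) *: a).
  by move=> k u v; rewrite linearP /= scalerDl scalerA.
have [|z zP] := @retract_summand _ (fgproj_eR ee) A
  (linear_of iL) (eR_mul e \o phi); last by exists z.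
move=> t; apply: val_inj; rewrite /= linearZ ea.
by rewrite -[RHS](eR_mulK ee); congr (e * _); apply: eR_mulK.
Qed.

(** The sums of terms [x g y] form the two-sided ideal generated by [g]. *)
Lemma simple_one_sum g : simple_ring R -> g <> 0 ->
  exists l : seq (R * R), 1 = \sum_(xy <- l) xy.1 * g * xy.2.
Proof.
move=> sR g0.
pose I : set R := [set x | exists l : seq (R * R),
  x = \sum_(xy <- l) xy.1 * g * xy.2].
suff II : two_sided_ideal I.
  have [I0|I1] := sR I II; last by have : I 1 by rewrite I1.
  have : I g by exists [:: (1, 1)]; rewrite big_seq1 mul1r mulr1.
  by rewrite I0 => /g0.
split; first split.
- by exists [::]; rewrite big_nil.
- move=> _ _ [l ->] [m ->]; exists (l ++ [seq (- xy.1, xy.2) | xy <- m]).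
  rewrite big_cat big_map /= -sumrN; congr (_ + _).
  by apply: eq_bigr => i _; rewrite !mulNr.
- move=> _ r [l ->]; exists [seq (xy.1, xy.2 * r) | xy <- l].
  by rewrite big_map mulr_suml; apply: eq_bigr => i _; rewrite /= !mulrA.
- move=> r _ [l ->]; exists [seq (r * xy.1, xy.2) | xy <- l].
  by rewrite big_map mulr_sumr; apply: eq_bigr => i _; rewrite /= !mulrA.
Qed.

(** With a dual basis [(s, phi)] of a module and [1 = \sum x g y], every element
    [a] is the sum of the [s x (g y (phi a))], whose terms factor through [gR]. *)
Lemma summand_of_idempotent_multiple g (gg : g * g = g) (y : V R) :
  simple_ring R -> g <> 0 ->
  exists n z, V_class (fgproj_eR gg) *+ n = y + z.
Proof.
move=> sR g0; have [A <-] := V_class_surj y.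
have [l lP] := dual_basis A; have [m mP] := simple_one_sum sR g0.
have uL (s : A) (x : R) : linear (fun t : eR_mod g => (x * val t : R^c) *: s).
  by move=> k u v; rewrite linearP /= scalerA -scalerDl; congr (_ *: _);
     rewrite mulrDr mulrA.
have vL (phi : {linear A -> (R^c)^o}) (y' : R) :
    linear (fun a : A => eR_mul g (y' * phi a) : eR_mod g).
  move=> k u v; rewrite -linearP linearP; congr (eR_mul g _).
  by rewrite /= mulrDr mulrA.
pose L : seq ({linear eR_mod g -> A} * {linear A -> eR_mod g}) :=
  [seq (linear_of (uL sf.1 xy.1), linear_of (vL sf.2 xy.2)) | sf <- l, xy <- m].
have [|z zP] := @summand_of_multiple _ A (fgproj_eR gg) L;
  last by exists (size L), z.
move=> a; rewrite [LHS]lP big_allpairs_dep; apply: eq_bigr => sf _ /=.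
rewrite -scaler_suml; congr (_ *: _).
rewrite -[LHS](mul1r (sf.2 a : R)) mP mulr_suml.
by apply: eq_bigr => xy _; rewrite !mulrA.
Qed.

(** From [E = E + n [gR]], where [E] is the class of [eR], every [y] is a summand
    of [E], and [x] has [E] as a summand.  Keeping one more copy of [E] in the
    complement makes the complement nonzero. *)
Lemma nonzero_absorbs (x y : V R) : purely_infinite_simple R -> x <> 0 ->
  exists2 z, z <> 0 & x = y + z.
Proof.
move=> piR x0; have [e [ee [w [einf ->]]]] := infinite_idempotent_summand piR x0.
have [g [gg [g0 eg]]] := infinite_idempotent_absorbs ee einf.
have [n [z nP]] := summand_of_idempotent_multiple gg y piR.1 g0.
set E := V_class (fgproj_eR ee) in eg *.
have En k : E = E + V_class (fgproj_eR gg) *+ k.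
  elim: k => [|k IH]; first by rewrite addr0.
  by rewrite mulrS addrA -eg.
exists (E + (z + w)); last by rewrite {1}(En n) nP addrCA !addrA.
move=> /viso_add_eq0 E0; apply: (V_class_eR_neq0 (ee := gg) g0).
by rewrite E0 add0r in eg.
Qed.

End IdempotentIdeals.

(** * Commutative monoids whose nonzero elements form a group *)

Section GroupWithNewZero.
Variable M : nmodType.
Hypothesis M_conical : forall x y : M, x + y = 0 -> x = 0.
Hypothesis M_absorbs :
  forall x y : M, x <> 0 -> exists2 z, z <> 0 & x = y + z.
Variable m : M.
Hypothesis m_neq0 : m <> 0.

(** A [u] with [m = m + u] works for all nonzero [x], as [m] is a summand of
    each of them. *)
Lemma nonzero_neutral :
  exists2 u : M, u <> 0 & forall x, x <> 0 -> x + u = x.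
Proof.
have [u u0 mu] := M_absorbs m m_neq0; exists u => // x x0.
by have [z _ ->] := M_absorbs m x0; rewrite addrAC -mu.
Qed.

Lemma nonzero_addrI (x y e : M) : x <> 0 -> y <> 0 -> x + e = y + e -> x = y.
Proof.
move=> x0 y0 xye; have [u u0 uP] := nonzero_neutral.
(* adding [z] undoes the addition of [e], even when [e] is zero *)
have [z _ uez] := M_absorbs e u0.
by rewrite -(uP x x0) -(uP y y0) uez !addrA xye.
Qed.

(** Adding the neutral element [u] to [a] preserves the class of [(a, b)] and
    makes [a] nonzero, hence divisible by [b]. *)
Lemma groth_of_surj (k : groth M) : exists2 x : M, x <> 0 & groth_of x = k.
Proof.
elim/quotW: k => -[a b]; have [u u0 uP] := nonzero_neutral.
have au0 : a + u <> 0 by rewrite addrC => /M_conical.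
have [z z0 auE] := M_absorbs b au0; exists z => //.
apply/groth_eqP; exists u => /=.
by rewrite addr0 (addrC z) -auE -addrA uP.
Qed.

Definition adjoin_zero_groth (x : M) : adjoin_zero (groth M) :=
  if x == 0 then None else Some (groth_of x).

Lemma adjoin_zero_groth_morphism : nmod_morphism adjoin_zero_groth.
Proof.
split; first by rewrite /adjoin_zero_groth eqxx.
move=> x y; rewrite /adjoin_zero_groth.
have [->|x0] := eqVneq x 0; first by rewrite add0r.
have [->|y0] := eqVneq y 0; first by rewrite addr0 (negbTE x0).
case: eqP => [/M_conical xE|_]; first by rewrite xE eqxx in x0.
by rewrite raddfD.
Qed.

Lemma monoid_iso_adjoin_zero_groth : monoid_iso M (adjoin_zero (groth M)).
Proof.
exists (HB.pack_for {additive M -> adjoin_zero (groth M)} adjoin_zero_groth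
  (GRing.isNmodMorphism.Build _ _ _ adjoin_zero_groth_morphism)).
apply: bij_of_inj_surj => /= [x y|[k|]]; rewrite /adjoin_zero_groth.
- case: eqP => [->|x0]; case: eqP => [->|y0] // [/groth_ofP[e]].
  exact: nonzero_addrI.
- by have [x /eqP/negbTE x0 <-] := groth_of_surj k; exists x; rewrite x0.
- by exists 0; rewrite eqxx.
Qed.

End GroupWithNewZero.

(** * Purely infinite simple rings *)

Unset Implicit Arguments.
Set Strict Implicit.
Set Printing Implicit Defensive.

Theorem corollary2p3 (R : nzRingType) :
  purely_infinite_simple R ->
  monoid_iso (V R) (adjoin_zero (K0 R)) /\ K0_pos R = [set: K0 R].
Proof.
move=> piR; have con := @viso_add_eq0 R^c.
have abs (x y : V R) := @nonzero_absorbs R x y piR.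
have R0 : V_class (fgproj_eR (mulr1 (1 : R))) <> 0.
  by apply: V_class_eR_neq0; apply/eqP/oner_neq0.
split; first exact (@monoid_iso_adjoin_zero_groth (V R) con abs _ R0).
apply/seteqP; split=> // k _.
by have [x _ <-] := groth_of_surj con abs R0 k; exists x.
Qed.
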